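(* Let $v>k\geq 2$ be integers and let $\Phi$ be a real or complex matrix whose columns form an equiangular tight frame (ETF) for their span and such that $|\Phi|^2$ is the $b\times v$ incidence matrix of a $\mathrm{BIBD}(v,k,1)$. Let $r:=\frac{v-1}{k-1}$ and $d:=\frac{vr}{r+k-1}$. Then $$u:=\frac{k(k-1)^2(k-2)}{v+k(k-2)}$$ is a nonnegative integer that divides both $k(k-1)(k-2)$ and $r(k-1)(k-2)$. Also, $u\leq\frac12(k-1)(k-2)$. Moreover, $$\biggl[\frac{d(v-1)}{v-d}\biggr]^{\frac12}=r,\qquad \biggl[\frac{(v-d)(v-1)}{d}\biggr]^{\frac12}=k-1.$$ In particular, if $k>2$ and $\Phi$ is real, then $v$ and $k$ are even, and $r$ is odd. Finally, for such $\Phi$ the following equivalences hold: (a) $u=0\ \Leftrightarrow\ k=2\ \Leftrightarrow\ v=d+1$; (b) $u=1\ \Leftrightarrow\ v=k^2(k-2)^2\ \Leftrightarrow\ v=(v-d)^2$; (c) $u=2\ \Leftrightarrow\ v=\binom{k(k-2)}{2}\ \Leftrightarrow\ v=\binom{v-d+1}{2}$; (d) ($u=\frac12(k-1)(k-2)$ and $k>2$) $\Leftrightarrow$ ($v=k^2$ and $k>2$) $\Leftrightarrow$ ($v-d=\frac12(v-v^{1/2})$ and $v>4$).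
   Context: Inner products on $\mathbb{F}^m$ ($\mathbb{F}=\mathbb{R}$ or $\mathbb{C}$) are standard dot products, conjugate-linear in the first argument. Vectors $\varphi_1,\dots,\varphi_n\in\mathbb{F}^m$ form an equiangular tight frame (ETF) for their span $H$ if they are nonzero with equal norms, there is a constant $w$ with $|\langle\varphi_i,\varphi_j\rangle|=w$ for all $i\neq j$, and there is $a>0$ with $\sum_{i=1}^n\langle\varphi_i,x\rangle\varphi_i=ax$ for all $x\in H$. For integers $v>k\geq 2$, a $\mathrm{BIBD}(v,k,1)$ is a $v$-element vertex set together with a collection of subsets, called blocks, such that every block contains exactly $k$ vertices and every pair of distinct vertices is contained in exactly one block. Letting $b$ be the number of blocks, its incidence matrix is the $b\times v$ $\{0,1\}$-matrix whose rows are indexed by blocks and columns by vertices, with $(i,j)$ entry $1$ iff the $j$th vertex lies in the $i$th block. $|\Phi|^2$ denotes the entrywise squared modulus of $\Phi$. The number $d$ is the dimension of the span of the columns of $\Phi$. ''Divides'' is divisibility of integers ($0$ divides only $0$), and $\binom{m}{2}=\frac{m(m-1)}2$. *)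

(* Defs.v *)
From HB Require Import structures.
From mathcomp Require Import all_boot all_order all_algebra.
From mathcomp Require Import reals complex.

Set Implicit Arguments.
Unset Strict Implicit.
Unset Printing Implicit Defensive.

Import Order.TTheory GRing.Theory Num.Theory.
Local Open Scope ring_scope.

Inductive scalar_kind := RealScalars | ComplexScalars.

Definition scalars_of (R : realType) (s : scalar_kind) : numFieldType :=
  match s with RealScalars => R | ComplexScalars => R[i] end.

Definition scalar_conj (R : realType) (s : scalar_kind) :
    scalars_of R s -> scalars_of R s :=
  match s with RealScalars => id | ComplexScalars => @conjc R end.

Definition inner (R : realType) (s : scalar_kind) (m : nat)
    (x y : 'cV[scalars_of R s]_m) : scalars_of R s :=
  \sum_(l < m) scalar_conj (x l 0) * y l 0.

(* The mathcomp relation (_ <= _)%MS compares row spaces, hence the transposes: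
   (x^T <= Phi^T)%MS says that x lies in the span of the columns of Phi.
   Equality of norms is stated on the squared norms <phi_j, phi_j>.  In the
   complex case 0 < a entails that a is real. *)
Definition etf_for_span (R : realType) (s : scalar_kind) (m n : nat)
    (Phi : 'M[scalars_of R s]_(m, n)) : Prop :=
  [/\ forall j : 'I_n, col j Phi != 0,
      forall i j : 'I_n,
        inner (col i Phi) (col i Phi) = inner (col j Phi) (col j Phi),
      exists w : scalars_of R s, forall i j : 'I_n, i != j ->
        `|inner (col i Phi) (col j Phi)| = w
    & exists2 a : scalars_of R s, 0 < a &
        forall x : 'cV[scalars_of R s]_m, (x^T <= Phi^T)%MS ->
          \sum_(i < n) inner (col i Phi) x *: col i Phi = a *: x].

Definition bibd1 (T : finType) (k : nat) (B : {set {set T}}) : Prop :=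
  (forall beta : {set T}, beta \in B -> #|beta| = k) /\
  (forall x y : T, x != y ->
     #|[set beta in B | (x \in beta) && (y \in beta)]| = 1%N).

(* blk enumerates the blocks without repetition; the vertex set is 'I_v. *)
Definition bibd1_incidence_mx (F : pzRingType) (b v k : nat)
    (M : 'M[F]_(b, v)) : Prop :=
  exists (B : {set {set 'I_v}}) (blk : 'I_b -> {set 'I_v}),
    [/\ bibd1 k B, injective blk, [set blk i | i : 'I_b] = B
      & M = \matrix_(i < b, j < v) (j \in blk i)%:R].

(* Main.v *)
Require Import Defs.
From mathcomp Require Import all_boot all_order all_algebra.
From mathcomp Require Import reals complex.
From mathcomp Require Import ring lra zify.
Import Order.TTheory GRing.Theory Num.Theory.
Local Open Scope ring_scope.

(* Write Psi for the conjugate transpose of Phi and G = Psi *m Phi.  Two columns of Phi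
   overlap in a single row, so G has diagonal r and unimodular off-diagonal entries, while
   tightness gives G^2 = a G.  A diagonal entry of this identity yields a = r + k - 1, and its
   trace yields v r = a d.  Then (v - d)(r + k - 1) = v (k - 1), hence
   u = k (k - 1)(k - 2) / (r + k - 1) = (k - 1)^2 - (v - d) is an integer.  Counting the blocks
   through a point off a given block gives r >= k, and integrality of u rules out r = k unless
   k = 2, which bounds u.  In the real case G = r + S with S a symmetric sign matrix satisfying
   S^2 = (k - 1 - r) S + (v - 1); comparing three rows of S modulo 4 shows that v and k - 1 - r
   are even. *)

(** * Counting in a design whose point pairs each lie in a single block *)

Section Design.
Local Open Scope nat_scope.
Variables (I T : finType) (blk : I -> {set T}) (k : nat).
Hypothesis card_blk : forall i, #|blk i| = k.
Hypothesis pair_blk : forall x y, x != y ->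
  #|[set i | (x \in blk i) && (y \in blk i)]| = 1.

Lemma sum_pair_blk x y : x != y ->
  \sum_(i | x \in blk i) (y \in blk i : nat) = 1.
Proof.
move=> /pair_blk <-; rewrite -sum1dep_card big_mkcond [RHS]big_mkcond /=.
by apply: eq_bigr => i _; case: (x \in _); case: (y \in _).
Qed.

(** Double count of the pairs of a point other than [x] and a block joining it to [x]. *)
Lemma design_degree x : #|[set i | x \in blk i]| * (k - 1) = #|T| - 1.
Proof.
have -> : #|T| - 1 = \sum_(y | y != x) \sum_(i | x \in blk i) (y \in blk i).
  rewrite (eq_bigr (fun=> 1)) => [|y yx]; last by apply: sum_pair_blk; rewrite eq_sym.
  by rewrite sum1_card cardC1 subn1.
rewrite exchange_big /= (eq_bigr (fun=> k - 1)) => [|i xi].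
  by rewrite sum_nat_const cardsE.
rewrite -(card_blk i) (cardsD1 x) xi addKn -sum1_card big_mkcond /=.
rewrite [RHS]big_mkcond; apply: eq_bigr => y _.
by rewrite !inE; case: (y == x); case: (y \in _).
Qed.

Lemma design_flags r : (forall x, #|[set i | x \in blk i]| = r) ->
  #|I| * k = #|T| * r.
Proof.
move=> deg; rewrite -!sum_nat_const.
rewrite (eq_bigr (fun i => \sum_x (x \in blk i : nat))); last first.
  by move=> i _; rewrite -(card_blk i) -sum1_card [LHS]big_mkcond; apply: eq_bigr => x _; case: ifP.
rewrite exchange_big; apply: eq_bigr => x _.
by rewrite -(deg x) -sum1dep_card [LHS]big_mkcond [RHS]big_mkcond; apply: eq_bigr => i _; case: ifP.
Qed.

Lemma card_blkI i j : i != j -> #|blk i :&: blk j| <= 1.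
Proof.
move=> ij; apply: contraNT ij; rewrite -ltnNge => /card_gt1P[x [y [xI yI xy]]].
move: xI yI; rewrite !inE => /andP[xi xj] /andP[yi yj].
have /eqP/cards1P[l L] := pair_blk x y xy.
have il : i \in [set l] by rewrite -L inE xi yi.
have jl : j \in [set l] by rewrite -L inE xj yj.
by move: il jl; rewrite !inE => /eqP-> /eqP->.
Qed.

(* The blocks joining a point x to the k points of a block missing x are distinct. *)
Lemma design_degree_ge r : 1 < #|T| -> k < #|T| ->
  (forall x, #|[set i | x \in blk i]| = r) -> k <= r.
Proof.
(* The two points serve to produce a block [j]. *)
move=> /card_gt1P[x0 [y0 [_ _ /pair_blk/eqP/cards1P[j _]]]] kT deg.
have [x xj] : exists x, x \notin blk j.
  apply/existsP; rewrite -negb_forall; apply: contraTN kT => /forallP all_in.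
  rewrite -leqNgt -(card_blk j) -cardsT subset_leq_card //.
  by apply/subsetP => y _; apply: all_in.
rewrite -(card_blk j) -sum1_card -(deg x) -sum1dep_card.
rewrite (eq_bigr (fun y => \sum_(i | x \in blk i) (y \in blk i : nat))) => [|y yj].
  rewrite exchange_big; apply: leq_sum => i xi /=.
  have ij : i != j by apply: contraNneq xj => <-.
  apply: leq_trans (card_blkI _ _ ij); rewrite -sum1_card [leqRHS]big_mkcond [leqLHS]big_mkcond.
  by apply: leq_sum => y _; rewrite inE; case: (y \in blk i); case: (y \in blk j).
by rewrite sum_pair_blk //; apply: contraNneq xj => ->.
Qed.

End Design.

(** Injectivity of [blk] lets blocks be counted by their indices. *)
Lemma bibd1_blk (v b k : nat) (B : {set {set 'I_v}}) (blk : 'I_b -> {set 'I_v}) :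
  bibd1 k B -> injective blk -> [set blk i | i : 'I_b] = B ->
  (forall i, #|blk i| = k) /\
  (forall x y, x != y -> #|[set i | (x \in blk i) && (y \in blk i)]| = 1%N).
Proof.
move=> [Bk B1] inj eB; split=> [i | x y xy]; first by apply: Bk; rewrite -eB imset_f.
rewrite -(B1 x y xy) -(card_imset _ inj); congr #|pred_of_set _|.
apply/setP => beta; rewrite inE -eB; apply/imsetP/andP => [[l] | [/imsetP[i _ ->] xyi]].
  by rewrite inE => xyl ->; rewrite imset_f.
by exists i; rewrite ?inE.
Qed.

(** * The rank of a tight matrix, and the parity of symmetric sign matrices *)

Lemma mxtrace_tight (F : fieldType) (m n : nat) (A : 'M[F]_(m, n)) (B : 'M[F]_(n, m)) a :
  A *m B *m A = a *: A -> \tr (B *m A) = a * (\rank A)%:R.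
Proof.
move=> tight.
have := mulmx_base A; have := row_base_free A; have := col_base_full A.
move: (col_base A) (row_base A); move: (\rank A) => d C D Cfull Dfree CD.
have -> : \tr (B *m A) = \tr (D *m B *m C) by rewrite -{1}CD mulmxA mxtrace_mulC mulmxA.
(* With A = C D a rank factorization, tightness reads C (D B C) D = a C D, where C and D cancel. *)
suff -> : D *m B *m C = a%:M by rewrite mxtrace_scalar mulr_natr.
apply: (row_free_inj Dfree); apply: (row_full_inj Cfull) => /=.
by rewrite mul_scalar_mx -scalemxAr CD !mulmxA CD -mulmxA CD.
Qed.

(* The three rows of signs satisfy 4 | (x + y) (x + z) in every column outside i, j, l. *)
Lemma sign_triple_mod4 (T : finType) (s : T -> T -> int) (c : int) (i j l : T) :
  (forall x y, x != y -> s x y = 1 \/ s x y = - 1) ->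
  (forall x y, s x y = s y x) ->
  (forall x y, x != y -> \sum_(z | (z != x) && (z != y)) s x z * s z y = c * s x y) ->
  i != j -> i != l -> j != l ->
  exists q : int, #|T|%:Z - 2 - c * (s i j * s j l * s i l) = 4 * q.
Proof.
move=> s1 sC sS ij il jl.
pose D := [pred m | [&& m != i, m != j & m != l]].
have restrict x y z : x != y -> x != z -> y != z ->
    D =1 [pred m | [&& m != x, m != y & m != z]] ->
    \sum_(m | D m) s x m * s m y = c * s x y - s x z * s z y.
  move=> xy xz yz DE; rewrite -sS // [in RHS](bigD1 z) /=; last by rewrite !(eq_sym z) xz yz.
  rewrite [RHS]addrC addKr; apply: eq_bigl => m; rewrite -andbA; exact: DE.
have cardD : #|T|%:Z = 3 + \sum_(m | D m) (1 : int).
  rewrite -natz -sumr_const (bigD1 i) //= (bigD1 j) /=; last by rewrite eq_sym.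
  rewrite (bigD1 l) /=; last by rewrite !(eq_sym l) il jl.
  by rewrite !addrA; congr (_ + _); apply: eq_bigl => m; rewrite /D /= !andbA.
have [q Dq] : exists q : int, \sum_(m | D m) (s i m + s j m) * (s i m + s l m) = 4 * q.
  apply: (big_ind (fun x : int => exists q : int, x = 4 * q)).
  - by exists 0.
  - by move=> _ _ [p ->] [q ->]; exists (p + q); rewrite mulrDr.
  move=> m /and3P[mi mj ml]; rewrite !(eq_sym m) in mi mj ml.
  by case: (s1 _ _ mi) (s1 _ _ mj) (s1 _ _ ml) => -> [] -> [] ->;
     [exists 1 | exists 0 | exists 0 | exists 0 | exists 0 | exists 0 | exists 0 | exists 1].
(* The product expands into a square, equal to 1, and three cross terms, each summed by the
   quadratic relation minus its term at the third index. *)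
have DqE : \sum_(m | D m) (s i m + s j m) * (s i m + s l m) =
   \sum_(m | D m) (1 : int) + (c * s i l - s i j * s j l) + (c * s i j - s i l * s l j)
     + (c * s j l - s j i * s i l).
  have [li lj] : l != i /\ l != j by rewrite !(eq_sym l).
  rewrite -(restrict i l j) // -?(restrict i j l) // -?(restrict j l i) //; try by rewrite eq_sym.
  all: try by move=> m; rewrite /D /=; do 3 case: (m == _).
  rewrite -!big_split /=; apply: eq_bigr => m /and3P[mi mj ml].
  rewrite (sC m l) (sC m j); rewrite eq_sym in mi.
  by case: (s1 _ _ mi) => ->; ring.
move: DqE; rewrite Dq (sC l j) (sC j i) => DqE.
move: cardD DqE; set S1 := \sum_(m | _) _; move: S1 => S1 -> {Dq}.
(* Modulo 4, three signs of sum S have product -S and pairwise products of sum -1, so [E] turns into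
   the claim. *)
case: (s1 _ _ ij) (s1 _ _ il) (s1 _ _ jl) => -> [] -> [] -> E.
all: by [exists q; lia | exists (q + 1 - c); lia | exists (q + 1 + c); lia
  | exists (q + 1); lia | exists (q - 1); lia].
Qed.

(** Fix i and j. The triple products [t l] sum to c, and unless c is one of the two excluded
    extremes both signs occur among them. Hence 4 divides both |T| - 2 - c and |T| - 2 + c; their
    half sum and half difference give the parities. *)
Lemma sign_matrix_even (T : finType) (s : T -> T -> int) (c : int) :
  (forall x y, x != y -> s x y = 1 \/ s x y = - 1) ->
  (forall x y, s x y = s y x) ->
  (forall x y, x != y -> \sum_(z | (z != x) && (z != y)) s x z * s z y = c * s x y) ->
  (1 < #|T|)%N -> c != #|T|%:Z - 2 -> c != 2 - #|T|%:Z ->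
  exists p q : int, #|T|%:Z = 2 * p /\ c = 2 * q.
Proof.
move=> s1 sC sS /card_gt1P[i [j [_ _ ij]]] cp cn.
pose t l := s i j * s j l * s i l.
have s2 : s i j * s i j = 1 by case: (s1 _ _ ij) => ->.
have sumt : \sum_(l | (l != i) && (l != j)) t l = c.
  rewrite -[RHS]mulr1 -s2 mulrA -sS // mulr_suml; apply: eq_bigr => l _.
  by rewrite /t (sC l j); ring.
have sum1 : \sum_(l | (l != i) && (l != j)) (1 : int) = #|T|%:Z - 2.
  rewrite -natz -sumr_const [in RHS](bigD1 i) //= [in RHS](bigD1 j) 1?eq_sym //=.
  by ring.
have t1 l : l != i -> l != j -> t l = 1 \/ t l = - 1.
  rewrite ![l == _]eq_sym => li lj; rewrite /t.
  by case: (s1 _ _ ij) (s1 _ _ li) (s1 _ _ lj) => -> [] -> [] ->;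
    [left|right|right|left|right|left|left|right].
have triple l : l != i -> l != j -> exists q, #|T|%:Z - 2 - c * t l = 4 * q.
  by rewrite ![l == _]eq_sym => li lj; apply: sign_triple_mod4.
have both e : e = 1 \/ e = - 1 -> c != - (e * (#|T|%:Z - 2)) ->
    exists q, #|T|%:Z - 2 - c * e = 4 * q.
  move=> e1 ce.
  case: (pickP [pred l | [&& l != i, l != j & t l == e]]) => [l /and3P[li lj /eqP <-]|none].
    exact: triple.
  case/eqP: ce; rewrite -sumt -sum1 mulr_sumr -sumrN; apply: eq_bigr => l /andP[li lj].
  have := none l; rewrite /= li lj mulr1 /=.
  by case: (t1 l li lj) e1 => -> [] ->.
have [||p Ep] := both 1; [by left | by rewrite mul1r opprB |].
have [||q Eq] := both (- 1); [by right | by rewrite mulN1r opprK |].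
by exists (p + q + 1), (q - p); lia.
Qed.

(** * The Gram matrix of a tight matrix supported on the design *)

Section IncidenceGram.
Variables (F : numFieldType) (b v : nat) (blk : 'I_b -> {set 'I_v}).
Variables (Phi : 'M[F]_(b, v)) (Psi : 'M[F]_(v, b)).
Hypothesis pair_blk : forall x y, x != y ->
  #|[set i | (x \in blk i) && (y \in blk i)]| = 1%N.
Hypothesis normPhi : forall l j, `|Phi l j| ^+ 2 = (j \in blk l)%:R.
Hypothesis PsiPhi : forall l j, Psi j l * Phi l j = `|Phi l j| ^+ 2.
Hypothesis Psi0 : forall l j, Phi l j = 0 -> Psi j l = 0.

Lemma gram_diag j : (Psi *m Phi) j j = #|[set i | j \in blk i]|%:R.
Proof.
rewrite mxE -sum1dep_card natr_sum [RHS]big_mkcond; apply: eq_bigr => l _.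
by rewrite PsiPhi normPhi; case: (j \in _).
Qed.

(** Only the row of the block joining i and j contributes to either entry, so the product regroups
    into two squared moduli equal to 1. The product form avoids conjugation, [Psi] being
    abstract. *)
Lemma gram_offdiag i j : i != j -> (Psi *m Phi) i j * (Psi *m Phi) j i = 1.
Proof.
move=> ij; have /eqP/cards1P[l L] := pair_blk _ _ ij.
have only x y : (x == i) && (y == j) || (x == j) && (y == i) ->
    (Psi *m Phi) x y = Psi x l * Phi l y.
  move=> xy; rewrite mxE (bigD1 l) //= big1 ?addr0 // => m ml.
  have : ~~ ((x \in blk m) && (y \in blk m)).
    have : m \notin [set l] by rewrite inE.
    by rewrite -L inE; case/orP: xy => /andP[/eqP-> /eqP->]; rewrite // andbC.
  have zero z : z \notin blk m -> Phi m z = 0.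
    move=> /negPf zm; apply/eqP; have := normPhi m z.
    by rewrite zm => /eqP; rewrite expf_eq0 normr_eq0.
  by case/nandP => /zero Phi0; [rewrite Psi0 ?mul0r | rewrite Phi0 mulr0].
rewrite !only ?eqxx ?orbT // mulrACA [Phi l j * _]mulrC mulrACA.
have := set11 l; rewrite -L inE => /andP[il jl].
by rewrite !PsiPhi !normPhi il jl mulr1.
Qed.

Variables (r K : nat) (a : F).
Hypothesis degree : forall j, #|[set i | j \in blk i]| = r.
Hypothesis degreeK : (r * K = v - 1)%N.
Hypothesis v_gt1 : (1 < v)%N.
Hypothesis tight : Phi *m Psi *m Phi = a *: Phi.

Lemma gram_sqr : (Psi *m Phi) *m (Psi *m Phi) = a *: (Psi *m Phi).
Proof. by rewrite -mulmxA (mulmxA Phi) tight scalemxAr. Qed.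

(** On the diagonal, G^2 = a G reads r^2 + (v - 1) = a r with v - 1 = r K, and r cancels. *)
Lemma frame_constant : a = (r + K)%:R.
Proof.
have r0 : r%:R != 0 :> F by rewrite pnatr_eq0; apply: contraTneq v_gt1; nia.
pose i : 'I_v := Ordinal (ltnW v_gt1).
have := congr1 (fun M : matrix F v v => M i i) gram_sqr.
rewrite mxE [RHS]mxE gram_diag degree (bigD1 i) //= gram_diag degree.
rewrite (eq_bigr (fun=> 1)) => [|l li]; last by rewrite gram_offdiag // eq_sym.
rewrite sumr_const cardC1 card_ord -subn1 -degreeK natrM -mulrDr mulrC.
by move=> /(mulIf r0) <-; rewrite natrD.
Qed.

Lemma gram_rank : (v * r = (r + K) * \rank Phi)%N.
Proof.
apply/eqP; rewrite -(eqr_nat F) !natrM -frame_constant; apply/eqP.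
rewrite -(mxtrace_tight _ _ _ _ _ _ tight) /mxtrace (eq_bigr (fun=> r%:R)).
  by rewrite sumr_const card_ord mulr_natl.
by move=> j _; rewrite gram_diag degree.
Qed.

(** Removing the two terms with a diagonal factor from the (i, j) entry of G^2 = (r + K) G leaves
    the sign relation with c = K - r. Once v is even, r K = v - 1 is odd. *)
Lemma real_gram_parity : (1 < K)%N -> (K < r)%N ->
  (forall i j, Psi i j = Phi j i) -> [/\ ~~ odd v, odd K & odd r].
Proof.
move=> K1 Kr PsiE.
pose G := Psi *m Phi.
have GC i j : G i j = G j i.
  by rewrite !mxE; apply: eq_bigr => l _; rewrite !PsiE mulrC.
have G1 i j : i != j -> G i j = 1 \/ G i j = - 1.
  move=> ij; have := gram_offdiag _ _ ij; rewrite -/G (GC j i) -expr2 => /eqP.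
  by rewrite sqrf_eq1 => /orP[] /eqP ->; [left | right].
pose s i j : int := if G i j == 1 then 1 else - 1.
have sE i j : i != j -> (s i j)%:~R = G i j.
  by rewrite /s => /G1[] ->; rewrite ?eqxx // eqNr oner_eq0.
have [||||||p [q [vp cq]]] := sign_matrix_even _ s (K%:Z - r%:Z); rewrite ?card_ord.
- by move=> i j _; rewrite /s; case: ifP; [left | right].
- by move=> i j; rewrite /s GC.
- move=> i j ij; apply/eqP; rewrite -(eqr_int F) rmorphM rmorphB rmorph_sum /= sE //.
  have := congr1 (fun M : matrix F v v => M i j) gram_sqr; rewrite -/G.
  rewrite mxE [RHS]mxE (bigD1 i) //= (bigD1 j) 1?eq_sym //= frame_constant.
  rewrite {1}/G {3}/G !gram_diag !degree natrD => E.
  under eq_bigr => l /andP[li lj] do rewrite rmorphM /= !sE 1?(eq_sym i) //.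
  move: E; set S := \sum_(_ | _) _ => E; apply/eqP; rewrite -!pmulrn.
  have -> : S = r%:R * G i j + (G i j * r%:R + S) - 2 * r%:R * G i j by ring.
  by rewrite E; ring.
- by [].
(* The extremes fail: K - r is negative while v - 2 is not, and K - r = 2 - v would mean (K - 1) (r
   + 1) = 0. *)
- by nia.
- by nia.
move: vp; rewrite card_ord => vp.
have : odd (r * K) by have := degreeK; have := v_gt1; lia.
by rewrite oddM => /andP[]; split=> //; lia.
Qed.

End IncidenceGram.

(** * Equations in u, v and e at the special values of u *)

Lemma mul2_bin2 m : (2 * 'C(m, 2) = m * (m - 1))%N.
Proof. by rewrite mulnC -[2%N]/(2`!) bin_ffact ffactnS ffactn1 subn1. Qed.

(* With q = k (k - 2), so that q + 1 = (k - 1)^2, the quantities of the theorem are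
   u = q (q + 1) / (v + q) and e = v - d = v (q + 1) / (v + q). *)
Section SpecialCases.
Local Open Scope nat_scope.

Lemma u_eq1 u v q : 1 < v ->
  u * (v + q) = q * (q + 1) -> u = 1 <-> v = q ^ 2.
Proof.
move=> v_gt1 uE; split=> [u1|vq]; first by move: uE; rewrite u1; nia.
have q0 : 0 < q by move: v_gt1; rewrite vq; case: (q).
suff /eqP : u * (q * (q + 1)) = 1 * (q * (q + 1)) by rewrite eqn_pmul2r => [/eqP//|]; nia.
by rewrite mul1n -uE vq; nia.
Qed.

(** For the converse, multiplying v = e^2 by (v + q)^2 gives v (v - 1) (v - q^2) = 0, where only the
    last factor can vanish. *)
Lemma v_eq_sqr e v q : 1 < v ->
  e * (v + q) = v * (q + 1) -> v = q ^ 2 <-> v = e ^ 2.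
Proof.
move=> v_gt1 eE; split=> [vq|ve].
  have q0 : 0 < q by move: v_gt1; rewrite vq; case: (q).
  suff /eqP : e * (q * (q + 1)) = q * (q * (q + 1)).
    by rewrite eqn_pmul2r => [/eqP->//|]; nia.
  by transitivity (e * (v + q)); [rewrite vq; ring | rewrite eE vq; ring].
have E : (v%:Z * ((v%:Z - q%:Z ^+ 2) * (v%:Z - 1)) = 0 :> int)%R.
  transitivity (v%:Z * (v%:Z + q%:Z) ^+ 2 - (v%:Z * (q%:Z + 1)) ^+ 2)%R; first by ring.
  have -> : (v%:Z * (q%:Z + 1) = e%:Z * (v%:Z + q%:Z))%R by lia.
  by rewrite {1}ve; ring.
by move/eqP: E; rewrite !mulf_eq0 => /orP[|/orP[]] /eqP; lia.
Qed.

Lemma u_eq2 u v q : 1 < v ->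
  u * (v + q) = q * (q + 1) -> u = 2 <-> v = 'C(q, 2).
Proof.
move=> v_gt1 uE; have H := mul2_bin2 q; split=> [u2|vq]; first by move: uE; rewrite u2; nia.
have q1 : 1 < q by case: (q) vq H => [|[|//]]; nia.
have : u * (q * (q + 1)) = 2 * (q * (q + 1)) by rewrite -{2}uE; nia.
by move/eqP; rewrite eqn_pmul2r => [/eqP//|]; nia.
Qed.

(** Likewise 2 v = e (e + 1), multiplied by (v + q)^2, gives v (v - 1) (2 v - q^2 + q) = 0. *)
Lemma v_eq_bin2 e v q : 1 < v ->
  e * (v + q) = v * (q + 1) -> v = 'C(q, 2) <-> v = 'C(e + 1, 2).
Proof.
move=> v_gt1 eE; have Hq := mul2_bin2 q; have := mul2_bin2 (e + 1); rewrite addnK => He.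
split=> [vq|ve].
  have q1 : 1 < q by rewrite -vq in Hq; case: (q) Hq => [|[|//]]; lia.
  suff eq : e + 1 = q by rewrite eq.
  have /eqP : (e + 1) * (q * (q + 1)) = q * (q * (q + 1)).
    have : 2 * (e * (v + q)) = 2 * (v * (q + 1)) by rewrite eE.
    by rewrite -vq in Hq; nia.
  by rewrite eqn_pmul2r => [/eqP//|]; nia.
have E : (v%:Z * ((v%:Z - 1) * (2 * v%:Z - q%:Z ^+ 2 + q%:Z)) = 0 :> int)%R.
  transitivity (2 * v%:Z * (v%:Z + q%:Z) ^+ 2 - (v%:Z * (q%:Z + 1)) ^+ 2
      - (v%:Z * (q%:Z + 1)) * (v%:Z + q%:Z))%R; first by ring.
  have -> : (v%:Z * (q%:Z + 1) = e%:Z * (v%:Z + q%:Z))%R by lia.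
  have -> : (2 * v%:Z = (e%:Z + 1) * e%:Z)%R by lia.
  by ring.
move/eqP: E; rewrite !mulf_eq0 => /orP[|/orP[]] /eqP; [lia|lia|].
by case: (q) Hq => [|n] Hq; nia.
Qed.

End SpecialCases.

(** Excludes r = k when k = n + 2 > 2: then r + k - 1 = 2 n + 3 would divide k (k - 1) (k - 2) with
    quotient u. *)
Lemma degree_neq_k u n : (0 < n)%N -> (u * (2 * n + 3) != (n + 2) * (n + 1) * n)%N.
Proof.
move=> n0; apply: contraTneq isT => uE.
(* With y = 2 n + 3, 8 (n + 2) (n + 1) n = (y + 1) (y - 1) (y - 3) = 3 modulo y. *)
have : (2 * n + 3 %| 3)%N.
  rewrite -(dvdn_addr _ (dvdn_mulr ((2 * n + 3) ^ 2) (dvdnn (2 * n + 3)))).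
  apply/dvdnP; exists (8 * u + 3 * (2 * n + 3) + 1)%N.
  transitivity (8 * (u * (2 * n + 3)) + (3 * (2 * n + 3) + 1) * (2 * n + 3))%N; last by ring.
  by rewrite uE; ring.
by move/dvdn_leq => /(_ isT); lia.
Qed.

(** * From the frame and the design to natural-number parameters *)

Lemma scalar_conj_mul (R : realType) (s : scalar_kind) (x : scalars_of R s) :
  scalar_conj x * x = `|x| ^+ 2.
Proof.
case: s x => x; first by rewrite real_normK ?num_real ?expr2.
by rewrite sqr_normc mulrC.
Qed.

Lemma scalar_conj0 (R : realType) (s : scalar_kind) : scalar_conj (0 : scalars_of R s) = 0.
Proof. by case: s => //; exact: conjc0. Qed.

Lemma scalar_conj_id (R : realType) (s : scalar_kind) (x : scalars_of R s) :
  x \is Num.real -> scalar_conj x = x.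
Proof. by case: s x => //= x /complex_realP[y ->]; rewrite conjc_real. Qed.

(** Every column of [Phi] lies in the span, so tightness applies to it; entry by entry this is the
    matrix equation. *)
Lemma etf_synthesis (R : realType) (s : scalar_kind) (b v : nat)
    (Phi : 'M[scalars_of R s]_(b, v)) : etf_for_span Phi ->
  exists a, Phi *m (\matrix_(j, l) scalar_conj (Phi l j)) *m Phi = a *: Phi.
Proof.
case=> _ _ _ [a _ frame]; exists a; apply/matrixP => l j.
have := frame (col j Phi); rewrite tr_col row_sub => /(_ isT) /matrixP /(_ l 0).
rewrite summxE => E; rewrite [RHS]mxE; move: E.
rewrite [RHS]mxE [X in _ = _ * X]mxE => <-; rewrite -mulmxA mxE; apply: eq_bigr => i _.
rewrite !mxE mulrC; congr (_ * _); apply: eq_bigr => m _.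
by rewrite !mxE.
Qed.

Lemma etf_parameters (R : realType) (s : scalar_kind) (v n b : nat)
    (Phi : 'M[scalars_of R s]_(b, v)) : (n.+2 < v)%N ->
  etf_for_span Phi -> bibd1_incidence_mx n.+2 (map_mx (fun x => `|x| ^+ 2) Phi) ->
  exists r : nat,
    [/\ v = (r * n.+1 + 1)%N, (b * n.+2 = v * r)%N, (n.+1 < r)%N,
        (v * r = (r + n.+1) * \rank Phi)%N
      & (0 < n)%N -> Phi \is a mxOver Num.real -> [/\ ~~ odd v, ~~ odd n.+2 & odd r]].
Proof.
move=> nv /etf_synthesis[a tight] [B [blk [bibd inj imB /matrixP incE]]].
have [blk_k blk_2] := bibd1_blk _ _ _ _ _ bibd inj imB.
have v1 : (1 < v)%N by lia.
pose r := #|[set i | Ordinal (ltnW v1) \in blk i]|.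
have degE x : (#|[set i | x \in blk i]| * n.+1 = v - 1)%N.
  by have := design_degree _ _ _ _ blk_k blk_2 x; rewrite card_ord subn1.
have deg x : #|[set i | x \in blk i]| = r.
  by apply/eqP; rewrite -(eqn_pmul2r (ltn0Sn n)) !degE.
have rE : (r * n.+1 = v - 1)%N by rewrite -(degE (Ordinal (ltnW v1))).
have normPhi l j : `|Phi l j| ^+ 2 = (j \in blk l)%:R by have := incE l j; rewrite !mxE.
set Psi := \matrix_(j, l) _ in tight.
have PsiPhi l j : Psi j l * Phi l j = `|Phi l j| ^+ 2 by rewrite mxE scalar_conj_mul.
have Psi0 l j : Phi l j = 0 -> Psi j l = 0 by rewrite mxE => ->; apply: scalar_conj0.
have kr : (n.+1 < r)%N.
  by apply: (design_degree_ge _ _ _ _ blk_k blk_2); rewrite ?card_ord.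
exists r; split=> //; first by lia.
- by have := design_flags _ _ _ _ blk_k _ deg; rewrite !card_ord.
- exact: (gram_rank _ _ _ _ _ _ blk_2 normPhi PsiPhi Psi0 _ _ _ deg rE v1 tight).
move=> n0 /mxOverP real.
have [] := real_gram_parity _ _ _ _ _ _ blk_2 normPhi PsiPhi Psi0 _ _ _ deg rE v1 tight _ kr.
- by [].
- by move=> i j; rewrite mxE scalar_conj_id.
by move=> *; split=> //; lia.
Qed.

(** * Consequences of the parameter equations *)

(* k = n + 2, so that k - 1 and k - 2 are not truncated, and e = v - d. *)
Section EtfArithmetic.
Variables (v n r d e u : nat).
Hypothesis nv : (n.+2 < v)%N.
Hypothesis vE : v = (r * n.+1 + 1)%N.
Hypothesis kr : (n.+1 < r)%N.
Hypothesis rkE : (v * r = (r + n.+1) * d)%N.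
Hypothesis deE : (d + e)%N = v.

Lemma codim_mul_degree : (e * r = d * n.+1)%N. Proof. lia. Qed.

Lemma codim_mulE : (e * (r + n.+1) = v * n.+1)%N. Proof. have := codim_mul_degree; lia. Qed.

(** Makes (k - 1)^2 - e, the future u, a natural number. *)
Lemma codim_le : (e <= n.+1 ^ 2)%N.
Proof.
have r0 : (0 < r + n.+1)%N by rewrite addnS.
by rewrite -(leq_pmul2r r0) codim_mulE vE; lia.
Qed.

Let q := (n.+2 * n)%N.

(** The identity v + q = (r + k - 1) (k - 1) links the denominators of d and u. *)
Lemma codim_q : (e * (v + q) = v * (q + 1))%N.
Proof.
have -> : (v + q = (r + n.+1) * n.+1)%N by rewrite /q vE; ring.
by rewrite mulnA codim_mulE /q; ring.
Qed.

(** e = 1 means v (k - 1) = r + k - 1, which v = r (k - 1) + 1 reduces to r (k - 1)^2 = r. *)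
Lemma codim_eq1 : n = 0%N <-> e = 1%N.
Proof.
have e1E : e = 1%N <-> (r * 1 = r * n.+1 ^ 2)%N.
  have r0 : (0 < r + n.+1)%N by rewrite addnS.
  split=> [e1|rr]; first by have := codim_mulE; rewrite e1 vE; lia.
  by apply/eqP; rewrite -(eqn_pmul2r r0) codim_mulE vE; apply/eqP; lia.
rewrite e1E; split=> [-> //|/eqP]; rewrite eqn_pmul2l; last by lia.
by rewrite eq_sym -[1%N](exp1n 2) eqn_exp2r // eqSS => /eqP.
Qed.

Lemma k_natr (R : realType) : n.+2%:R = n%:R + 2 :> R. Proof. by rewrite -addn2 natrD. Qed.

Lemma v_natr (R : realType) : v%:R = r%:R * (n%:R + 1) + 1 :> R.
Proof. by rewrite vE natrD natrM -[n.+1]addn1 natrD. Qed.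

Lemma codim_natr (R : realType) : v%:R - d%:R = e%:R :> R.
Proof. by rewrite -deE natrD addrAC subrr add0r. Qed.

Lemma degree_gt0 (R : realType) : 0 < r%:R :> R. Proof. by rewrite ltr0n; lia. Qed.

Lemma codim_gt0 (R : realType) : 0 < e%:R :> R.
Proof.
rewrite ltr0n lt0n; apply: contraTneq nv => e0.
by move: codim_mulE => /esym/eqP; rewrite e0 mul0n muln_eq0; lia.
Qed.

Lemma dim_gt0 (R : realType) : 0 < d%:R :> R.
Proof.
rewrite ltr0n lt0n; apply: contraTneq nv => d0.
by move: rkE => /eqP; rewrite d0 muln0 muln_eq0; lia.
Qed.

Lemma codim_mul_natr (R : realType) : e%:R * r%:R = d%:R * (n%:R + 1) :> R.
Proof. by rewrite -natrM codim_mul_degree natrM -[n.+1]addn1 natrD. Qed.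

Lemma r_formula (R : realType) : r%:R = (v%:R - 1) / (n.+2%:R - 1) :> R.
Proof.
have n0 : 0 <= n%:R :> R by [].
by rewrite v_natr k_natr; field; lra.
Qed.

Lemma d_formula (R : realType) : d%:R = v%:R * r%:R / (r%:R + n.+2%:R - 1) :> R.
Proof.
have n0 : 0 <= n%:R :> R by [].
have := degree_gt0 R; rewrite k_natr => r0; apply: canRL (mulfK _) _; first by lra.
by rewrite -natrM rkE natrM natrD -[n.+1]addn1 natrD; ring.
Qed.

(** By v - 1 = r (k - 1) and e r = d (k - 1), the radicand is r^2; in [sqrt_k] the same relations
    give (k - 1)^2. *)
Lemma sqrt_r (R : realType) : Num.sqrt (d%:R * (v%:R - 1) / (v%:R - d%:R)) = r%:R :> R.
Proof.
have -> : d%:R * (v%:R - 1) / (v%:R - d%:R) = r%:R ^+ 2 :> R.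
  apply/esym/(canRL (mulfK _)); rewrite codim_natr ?gt_eqF ?codim_gt0 // v_natr addrK.
  by rewrite mulrCA -codim_mul_natr; ring.
by rewrite sqrtr_sqr ger0_norm.
Qed.

Lemma sqrt_k (R : realType) : Num.sqrt ((v%:R - d%:R) * (v%:R - 1) / d%:R) = n.+2%:R - 1 :> R.
Proof.
have -> : (v%:R - d%:R) * (v%:R - 1) / d%:R = (n%:R + 1) ^+ 2 :> R.
  apply/esym/(canRL (mulfK _)); rewrite ?gt_eqF ?dim_gt0 // codim_natr v_natr addrK.
  by rewrite mulrA codim_mul_natr; ring.
have n0 : 0 <= n%:R :> R by [].
by rewrite sqrtr_sqr k_natr ger0_norm; lra.
Qed.

(** For the converse put t = sqrt v. Substituting 2 e = t^2 - t in [codim_q] gives t (t + 1) ((t -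
    1)^2 - (k - 1)^2) = 0, and t > 2 leaves t = k. *)
Lemma v_eq_sqr_sqrt (R : realType) : (v = n.+2 ^ 2 /\ 2 < n.+2)%N <->
  e%:R = (v%:R - Num.sqrt v%:R) / 2 :> R /\ (4 < v)%N.
Proof.
have eqR := congr1 (fun m => m%:R : R) codim_q; rewrite !(natrM, natrD) k_natr in eqR.
have n0 : 0 <= n%:R :> R by [].
split=> [[vk n1]|[eR v4]].
  have vR : v%:R = (n%:R + 2) ^+ 2 :> R by rewrite vk natrX k_natr.
  split; last by nia.
  rewrite vR sqrtr_sqr ger0_norm; last by lra.
  (* At v = k^2 the factor v + q is 2 k (k - 1) / 1, with n + 2 for k, and it is half of nothing
     else: it is the factor to cancel. *)
  have nz : 2 * (n%:R + 2) * (n%:R + 1) != 0 :> R by apply/lt0r_neq0; nra.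
  apply: (mulIf nz); rewrite vR in eqR.
  have -> : e%:R * (2 * (n%:R + 2) * (n%:R + 1))
    = e%:R * ((n%:R + 2) ^+ 2 + (n%:R + 2) * n%:R) :> R by ring.
  by rewrite eqR; field.
pose t : R := Num.sqrt v%:R.
have tv : t ^+ 2 = v%:R by rewrite sqr_sqrtr.
have t0 : 0 <= t by rewrite sqrtr_ge0.
have t2 : 2 < t.
  have : 4 < v%:R :> R by rewrite ltr_nat.
  by rewrite -tv; nra.
have E : t * (t + 1) * ((t - 1) ^+ 2 - (n%:R + 1) ^+ 2) = 0.
  have H : (t ^+ 2 - t) * (t ^+ 2 + (n%:R + 2) * n%:R) = 2 * (t ^+ 2 * ((n%:R + 2) * n%:R + 1)).
    by rewrite tv -eqR eR -/t; field.
  transitivity ((t ^+ 2 - t) * (t ^+ 2 + (n%:R + 2) * n%:R)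
    - 2 * (t ^+ 2 * ((n%:R + 2) * n%:R + 1))); first by ring.
  by rewrite H subrr.
have tk : t = n%:R + 2.
  move/eqP: E; rewrite !mulf_eq0 subr_eq0 eqf_sqr => /orP[/orP[]|/orP[]] /eqP; lra.
have vk : v = (n.+2 ^ 2)%N.
  by apply/eqP; rewrite -(eqr_nat R) natrX -tv tk k_natr.
by split=> //; move: v4; rewrite vk; case: (n).
Qed.

Hypothesis ueE : (u + e)%N = (n.+1 ^ 2)%N.

(** Expand ((k - 1)^2 - e) (r + k - 1) using e (r + k - 1) = v (k - 1) and v = r (k - 1) + 1. *)
Lemma u_mulE : (u * (r + n.+1) = n.+2 * n.+1 * n)%N. Proof. have := codim_mulE; nia. Qed.

Lemma degree_gt_k : n = 0%N \/ (n.+3 <= r)%N.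
Proof.
case: (posnP n) => [|n0]; [by left | right].
rewrite ltn_neqAle kr andbT; apply: contraNneq (degree_neq_k u n n0) => rk.
by apply/eqP; move: u_mulE; rewrite -rk; lia.
Qed.

(** For k > 2, r > k gives r + k - 1 >= 2 k, and k cancels in [u_mulE]. *)
Lemma u_le_half : (2 * u <= n.+1 * n)%N.
Proof.
case: degree_gt_k => [n0|rn]; first by move: u_mulE => /eqP; rewrite n0 !muln0 muln_eq0; lia.
have : (u * (2 * n.+2) <= u * (r + n.+1))%N by rewrite leq_mul2l; lia.
by rewrite u_mulE -[(2 * u <= _)%N](@leq_pmul2l n.+2) //; lia.
Qed.

(** The cofactor is r (r + k - 1) / k, an integer because the flag count b k = v r gives r (r + k -
    1) = k (r^2 + r - b). *)
Lemma u_dvd b : (b * n.+2 = v * r)%N -> (u %| r * n.+1 * n)%N.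
Proof.
move=> flags.
have [m mE] : exists m, (r * (r + n.+1) = n.+2 * m)%N.
  by exists (r ^ 2 + r - b)%N; rewrite mulnBr [(n.+2 * b)%N]mulnC flags vE; clear; nia.
apply/dvdnP; exists m; apply/eqP; rewrite -(@eqn_pmul2l n.+2) //; apply/eqP.
by rewrite [RHS]mulnA -mE -[RHS]mulnA [((r + _) * u)%N]mulnC u_mulE; ring.
Qed.

Lemma u_q : (u * (v + q) = q * (q + 1))%N.
Proof. by have := u_mulE; rewrite /q vE; nia. Qed.

Lemma u_eq0 : u = 0%N <-> n = 0%N.
Proof.
split=> [u0|n0]; first by move: u_mulE => /esym/eqP; rewrite u0 mul0n !muln_eq0 => /eqP.
by move: u_mulE => /eqP; rewrite n0 muln0 muln_eq0; lia.
Qed.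

(** Both sides say r + k - 1 = 2 k, that is r = k + 1. *)
Lemma v_eq_sqr_k : (2 * u = n.+1 * n /\ (2 < n.+2) <-> v = n.+2 ^ 2 /\ (2 < n.+2))%N.
Proof.
split=> [[u2 n0]|[vk n0]]; split=> //.
  suff : (r + n.+1 = 2 * n.+2)%N by rewrite vE; nia.
  apply/eqP; rewrite -(@eqn_pmul2l (n.+1 * n)); last by rewrite muln_gt0.
  by rewrite -u2 -mulnA u_mulE u2; apply/eqP; ring.
have rn : r = n.+3.
  apply/eqP; rewrite -(@eqn_pmul2r n.+1) //; apply/eqP; move: vE; rewrite vk; nia.
apply/eqP; rewrite -(@eqn_pmul2l n.+2) //; apply/eqP.
by move: u_mulE; rewrite rn; nia.
Qed.

Lemma u_formula (R : realType) :
  u%:R = n.+2%:R * (n.+2%:R - 1) ^+ 2 * (n.+2%:R - 2)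
    / (v%:R + n.+2%:R * (n.+2%:R - 2)) :> R.
Proof.
have n0 : 0 <= n%:R :> R by [].
have v0 : 0 < v%:R :> R by rewrite ltr0n; lia.
have := congr1 (fun m => m%:R : R) u_q; rewrite !(natrM, natrD) k_natr => uqR.
apply: canRL (mulfK _) _; first by nra.
by transitivity (u%:R * (v%:R + (n%:R + 2) * n%:R) : R); [ring | rewrite uqR; ring].
Qed.

Lemma u_bound (R : realType) : u%:R <= (n.+2%:R - 1) * (n.+2%:R - 2) / 2 :> R.
Proof.
by have := u_le_half; rewrite k_natr -(ler_nat R) !natrM -[n.+1]addn1 natrD; lra.
Qed.

End EtfArithmetic.

Theorem theorem3p5 (R : realType) (s : scalar_kind) (v k b : nat)
    (hk : (2 <= k)%N) (hkv : (k < v)%N)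
    (Phi : 'M[scalars_of R s]_(b, v))
    (hetf : etf_for_span Phi)
    (hbibd : bibd1_incidence_mx k (map_mx (fun x => `|x| ^+ 2) Phi)) :
  exists r d u : nat,
    [/\ r%:R = (v%:R - 1) / (k%:R - 1) :> R,
        d%:R = v%:R * r%:R / (r%:R + k%:R - 1) :> R,
        d = \rank Phi
      & u%:R = k%:R * (k%:R - 1) ^+ 2 * (k%:R - 2)
               / (v%:R + k%:R * (k%:R - 2)) :> R] /\
    [/\ (u %| k * (k - 1) * (k - 2))%N,
        (u %| r * (k - 1) * (k - 2))%N
      & u%:R <= (k%:R - 1) * (k%:R - 2) / 2 :> R] /\
    [/\ Num.sqrt (d%:R * (v%:R - 1) / (v%:R - d%:R)) = r%:R :> R
      & Num.sqrt ((v%:R - d%:R) * (v%:R - 1) / d%:R) = k%:R - 1 :> R] /\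
    ((2 < k)%N -> Phi \is a mxOver Num.real ->
       [/\ ~~ odd v, ~~ odd k & odd r]) /\
    (* (a) *)
    [/\ u = 0%N <-> k = 2%N
      & k = 2%N <-> v = (d + 1)%N] /\
    (* (b) *)
    [/\ u = 1%N <-> v = (k ^ 2 * (k - 2) ^ 2)%N
      & v = (k ^ 2 * (k - 2) ^ 2)%N <-> v%:R = (v%:R - d%:R) ^+ 2 :> R] /\
    (* (c): d is a matrix rank, so d <= v and v - d + 1 is not truncated. *)
    [/\ u = 2%N <-> v = 'C(k * (k - 2), 2)
      & v = 'C(k * (k - 2), 2) <-> v = 'C(v - d + 1, 2)] /\
    (* (d) *)
    [/\ (u%:R = (k%:R - 1) * (k%:R - 2) / 2 :> R /\ (2 < k)%N) <->
        (v = (k ^ 2)%N /\ (2 < k)%N)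
      & (v = (k ^ 2)%N /\ (2 < k)%N) <->
        (v%:R - d%:R = (v%:R - Num.sqrt v%:R) / 2 :> R /\ (4 < v)%N)].
Proof.
case: k hk hkv hbibd => [|[|n]] // _ nv bibd.
have [r [vE flags kr rkE parity]] := etf_parameters _ _ _ _ _ _ nv hetf bibd.
move: (erefl (\rank Phi)) rkE; move: {2 3}(\rank Phi) => d dE rkE.
have [e deE] : exists e, (d + e)%N = v.
  by exists (v - d)%N; rewrite subnKC // -dE rank_leq_col.
(* u enters as (k - 1)^2 - (v - d); [u_formula] recovers the fraction. *)
have [u ueE] : exists u, (u + e)%N = (n.+1 ^ 2)%N.
  by exists (n.+1 ^ 2 - e)%N; rewrite subnK // (@codim_le v n r d).
have v1 : (1 < v)%N by lia.
have evd : (v - d)%N = e by rewrite -deE addKn.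
have uq := u_q _ _ _ _ _ _ nv vE kr rkE deE ueE.
have eq := codim_q _ _ _ _ _ nv vE kr rkE deE.
have vdR : v%:R - d%:R = e%:R :> R by apply: codim_natr.
have uR : u%:R = (n.+2%:R - 1) * (n.+2%:R - 2) / 2 :> R <-> (2 * u = n.+1 * n)%N.
  have -> : (n.+2%:R - 1) * (n.+2%:R - 2) = (n.+1 * n)%:R :> R.
    by rewrite k_natr natrM -[n.+1]addn1 natrD; ring.
  split=> [uR|<-]; last by rewrite natrM; field.
  by apply/eqP; rewrite -(eqr_nat R) natrM uR; apply/eqP; field.
have kq : (n.+2 * (n.+2 - 2) = n.+2 * n)%N by rewrite !subSS subn0.
(* Folding k^2 (k - 2)^2 into (k (k - 2))^2 puts (b) in terms of q = k (k - 2). *)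
exists r, d, u; rewrite kq -expnMn kq evd.
split; last split; last split; last split; last split; last split; last split.
- split=> //.
  + exact: r_formula.
  + exact: d_formula _ _ _ _ _ nv vE kr rkE deE R.
  + exact: u_formula _ _ _ _ _ _ nv vE kr rkE deE ueE R.
- rewrite !subSS !subn0; split.
  + by rewrite -(u_mulE _ _ _ _ _ _ nv vE kr rkE deE ueE) dvdn_mulr.
  + exact: u_dvd _ _ _ _ _ _ nv vE kr rkE deE ueE _ flags.
  + exact: u_bound _ _ _ _ _ _ nv vE kr rkE deE ueE R.
- split; [exact: sqrt_r _ _ _ _ _ nv vE kr rkE deE R | exact: sqrt_k _ _ _ _ _ nv vE kr rkE deE R].
- by move=> k2; apply: parity.
- have k2 : n = 0%N <-> n.+2 = 2%N by split=> [-> | []].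
  rewrite -k2; split; first exact: u_eq0 _ _ _ _ _ _ nv vE kr rkE deE ueE.
  rewrite (codim_eq1 _ _ _ _ _ nv vE kr rkE deE) -deE.
  by split=> [-> // | /addnI].
- split; first exact: u_eq1 _ _ _ v1 uq.
  rewrite (v_eq_sqr _ _ _ v1 eq) vdR -natrX.
  by split=> [<- // | /eqP]; rewrite eqr_nat => /eqP.
- by split; [exact: u_eq2 _ _ _ v1 uq | exact: v_eq_bin2 _ _ _ v1 eq].
- rewrite uR vdR; split; first exact: v_eq_sqr_k _ _ _ _ _ _ nv vE kr rkE deE ueE.
  exact: v_eq_sqr_sqrt _ _ _ _ _ nv vE kr rkE deE R.
Qed.
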